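(* Let $\mathcal{X}$ be a finite set and let $s$ be a similarity function on $\mathcal{X}$ that is ultrametric, i.e. $s(x,y)\ge\min\{s(x,z),s(y,z)\}$ for all $x,y,z\in\mathcal{X}$. Let $T^*=T^*(\mathcal{X},s)$ be the finest valid hierarchy with respect to $s$. Then there exists a function $h:T^*\to\mathbb{R}_+$ such that $h(t)>h(t')$ for all $t,t'\in T^*$ with $t\subsetneq t'$, and $$\forall (x,y)\in\mathcal{X}\times\mathcal{X}:\quad s(x,y)=h(\mathrm{lca}_{T^*}(x,y)).$$
   Context: $\mathbb{R}_+=[0,\infty)$. A similarity function on $\mathcal{X}$ is a symmetric map $s:\mathcal{X}\times\mathcal{X}\to\mathbb{R}_+$ with $s(x,x)>s(x,y)$ for all $x\ne y$. A nonempty subset $C\subseteq\mathcal{X}$ is a valid cluster if $s(x,y)>s(x,z)$ for all $x,y\in C$ and $z\in\mathcal{X}\setminus C$. The finest valid hierarchy $T^*(\mathcal{X},s)$ is the set of all valid clusters; it is a laminar family of nonempty subsets of $\mathcal{X}$ (any two members are disjoint or nested) containing $\mathcal{X}$ and all singletons, viewed as a rooted tree with root $\mathcal{X}$ and leaves the singletons. For $x,y\in\mathcal{X}$, $\mathrm{lca}_{T^*}(x,y)$ (least common ancestor) is the smallest element of $T^*$ containing both $x$ and $y$ (so $\mathrm{lca}_{T^*}(x,x)=\{x\}$). *)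

(* Defs.v *)
From mathcomp Require Import all_boot all_order all_algebra.
From mathcomp Require Import reals.

Set Implicit Arguments.
Unset Strict Implicit.
Unset Printing Implicit Defensive.

Import Order.TTheory GRing.Theory Num.Theory.
Local Open Scope ring_scope.

Section Hierarchy.
Variables (R : realType) (X : finType).
Implicit Types (s : X -> X -> R) (C : {set X}).

Record similarity s : Prop := Similarity {
  sim_ge0 : forall x y, 0 <= s x y;
  sim_sym : forall x y, s x y = s y x;
  sim_self : forall x y, x != y -> s x y < s x x }.

Definition ultrametric s : Prop :=
  forall x y z, Num.min (s x z) (s y z) <= s x y.

Definition valid_cluster s C : bool :=
  (C != set0) &&
  [forall x in C, forall y in C, forall z in ~: C, s x z < s x y].

Definition finest_hierarchy s : {set {set X}} := [set C | valid_cluster s C].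

Definition node s := {C : {set X} | C \in finest_hierarchy s}.

Definition least_node s x y (t : node s) : bool :=
  [&& x \in val t, y \in val t &
   [forall u : node s, (x \in val u) && (y \in val u) ==>
                       (val t \subset val u)]].

Lemma valid_clusterP s C x y z :
  C \in finest_hierarchy s -> x \in C -> y \in C -> z \notin C ->
  s x z < s x y.
Proof.
rewrite inE => /andP[_ /forall_inP vC] xC yC zC.
by move: (vC x xC) => /forall_inP/(_ y yC)/forall_inP; apply; rewrite inE.
Qed.

Lemma hierarchy_nested s C D x :
  C \in finest_hierarchy s -> D \in finest_hierarchy s ->
  x \in C -> x \in D -> (C \subset D) || (D \subset C).
Proof.
move=> vC vD xC xD; apply/orP.
have [|/subsetPn[a aC aD]] := boolP (C \subset D); first by left.
right; apply/subsetP => b bD; apply/contraT => bC.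
have := valid_clusterP vC xC aC bC.
by rewrite ltNge ltW // (valid_clusterP vD xD bD aD).
Qed.

Lemma setT_hierarchy s (x : X) : [set: X] \in finest_hierarchy s.
Proof.
rewrite inE; apply/andP; split; first by apply/set0Pn; exists x; rewrite inE.
apply/forall_inP => a _; apply/forall_inP => b _.
by apply/forall_inP => c; rewrite !inE.
Qed.

Lemma least_node_exists s (x y : X) : exists t : node s, least_node x y t.
Proof.
pose P (t : node s) := (x \in val t) && (y \in val t).
pose t0 : node s := Sub [set: X] (setT_hierarchy s x).
have Pt0 : P t0 by rewrite /P /= !inE.
case: (arg_minnP (fun t : node s => #|val t|) Pt0) => t /andP[xt yt] tmin.
exists t; rewrite /least_node xt yt /=; apply/forallP => u; apply/implyP => Pu.
have /andP[xu _] := Pu.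
have /orP[//|ut] := hierarchy_nested (valP t) (valP u) xt xu.
suff /eqP -> : val u == val t by [].
by rewrite eqEcard ut tmin.
Qed.

(* The choice made by [xchoose] is irrelevant: by antisymmetry of inclusion,
   at most one node satisfies [least_node x y]. *)
Definition lca s (x y : X) : node s := xchoose (least_node_exists s x y).

End Hierarchy.

(* Main.v *)
(** Take h(t) to be the smallest similarity between two points of t. It strictly
    decreases as t grows because a valid cluster t separates its own pairs from
    the points outside it. For ultrametric s, the ball of all z with
    s(x,z) >= s(x,y) is a valid cluster, so it contains lca(x,y), and hence
    s(x,y) is the smallest similarity in lca(x,y). *)

Require Import Defs.
From mathcomp Require Import all_boot all_order all_algebra.
From mathcomp Require Import reals.
Import Order.TTheory.
Local Open Scope ring_scope.

(** For [a], [b] in the ball and [z] outside, [s a z <= s x z < s x y <= s a b]; both outer bounds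
    are ultrametric, the last one through [x]. *)
Lemma ball_hierarchy (R : realType) (X : finType) (s : X -> X -> R) (x y : X) :
  similarity s -> ultrametric s ->
  [set z | s x y <= s x z] \in finest_hierarchy s.
Proof.
move=> hsim hult; have sC := sim_sym hsim.
rewrite inE; apply/andP; split; first by apply/set0Pn; exists y; rewrite inE.
apply/forall_inP => a; rewrite inE => xa.
apply/forall_inP => b; rewrite inE => xb.
apply/forall_inP => z; rewrite !inE -ltNge => xz.
apply: (@lt_le_trans _ _ (s x y)).
  (* The minimum of [s x a] and [s a z] cannot be [s x a], which is at least [s x y > s x z]. *)
  have := hult x z a; rewrite (sC z) ge_min => /orP[az|az].
    by have := lt_le_trans xz (le_trans xa az); rewrite ltxx.
  exact: le_lt_trans az xz.
by apply: le_trans (hult a b x); rewrite le_min (sC a) (sC b) xa.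
Qed.

Lemma lca_le (R : realType) (X : finType) (s : X -> X -> R) (x y a b : X) :
  similarity s -> ultrametric s ->
  a \in val (lca s x y) -> b \in val (lca s x y) -> s x y <= s a b.
Proof.
move=> hsim hult; have /and3P[_ _ /forallP tmin] := xchooseP (least_node_exists s x y).
(* This puts the centre [x] in the ball, as minimality of the lca requires. *)
have xyxx : s x y <= s x x.
  by have [<-//|xy] := eqVneq x y; apply/ltW/(sim_self hsim).
pose ball : node s :=
  Sub [set z | s x y <= s x z] (ball_hierarchy _ _ _ x y hsim hult).
have := tmin ball.
rewrite /= !inE xyxx lexx /= => /subsetP tB /tB + /tB; rewrite !inE => xa xb.
by apply: le_trans (hult a b x); rewrite le_min !(sim_sym hsim _ x) xa.
Qed.

(** The minimum is kept as a pair attaining it, since strict monotonicity of the height needs its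
    endpoints; being boolean, it suits [xchoose]. *)
Definition least_similar_pair {R : realType} {X : finType} (s : X -> X -> R)
    (C : {set X}) (p : X * X) : bool :=
  [&& p.1 \in C, p.2 \in C &
   [forall a in C, forall b in C, s p.1 p.2 <= s a b]].

Lemma least_similar_pair_exists (R : realType) (X : finType) (s : X -> X -> R)
    (C : {set X}) : C != set0 -> exists p, least_similar_pair s C p.
Proof.
case/set0Pn => x xC.
case: (@arg_minP _ _ _ (x, x) (fun p => (p.1 \in C) && (p.2 \in C))
         (fun p => s p.1 p.2)) => [|p /andP[pC qC] pmin]; first by rewrite xC.
exists p; rewrite /least_similar_pair pC qC /=.
apply/forall_inP => a aC; apply/forall_inP => b bC.
by apply: (pmin (a, b)); rewrite aC.
Qed.

Theorem lemma6 (R : realType) (X : finType) (s : X -> X -> R)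
    (hsim : similarity s) (hult : ultrametric s) :
  exists h : node s -> R,
    [/\ forall t : node s, 0 <= h t,
        forall t t' : node s, val t \proper val t' -> h t > h t'
      & forall x y : X, s x y = h (lca s x y)].
Proof.
have node_neq0 (t : node s) : val t != set0.
  by have := valP t; rewrite inE => /andP[].
pose pair t := xchoose (least_similar_pair_exists _ _ s _ (node_neq0 t)).
have pairP t : [/\ (pair t).1 \in val t, (pair t).2 \in val t &
    {in val t &, forall a b, s (pair t).1 (pair t).2 <= s a b}].
  have /and3P[p1 p2 /forall_inP pmin] :=
    xchooseP (least_similar_pair_exists _ _ s _ (node_neq0 t)).
  by split=> // a b /pmin/forall_inP; apply.
exists (fun t => s (pair t).1 (pair t).2); split.
- by move=> t; apply: sim_ge0.
- move=> t t' /properP[/subsetP tt' [z zt' zt]].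
  have [p1 p2 _] := pairP t; have [_ _ pmin] := pairP t'.
  (* The intermediate value is [s (pair t).1 z], the similarity of two points of [t']. *)
  apply: le_lt_trans (valid_clusterP (valP t) p1 p2 zt).
  by apply: pmin => //; apply: tt'.
- move=> x y; have [p1 p2 pmin] := pairP (lca s x y).
  have /and3P[xt yt _] := xchooseP (least_node_exists s x y).
  (* [lca_le] is applied to the minimizing pair, [pmin] to [x] and [y]. *)
  by apply/le_anti; rewrite lca_le //= pmin.
Qed.
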